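(* For all words $\mathbf{w},\mathbf{u}\in\mathfrak{T}_1^1$, all words $\mathbf{v}\in\mathfrak{T}_2^1$ and all $s\in\mathbb{N}$, the following identities hold in $\mathcal{A}$: (i) $T_{\mathcal{A}}(\mathbf{u}\,ш\,\mathbf{v})=T_{\mathcal{A}}(\tau(\mathbf{u})\mathbf{v})$ if $\operatorname{dep}(\mathbf{u})+\operatorname{dep}(\mathbf{v})$ is even; (ii) $T_{\mathcal{A}}\big((\mathbf{w}\mathbf{u})\,ш\,\mathbf{v}\big)=T_{\mathcal{A}}\big(\mathbf{u}\,ш\,(\tau(\mathbf{w})\mathbf{v})\big)$ if $\operatorname{dep}(\mathbf{u})+\operatorname{dep}(\mathbf{v})+\operatorname{dep}(\mathbf{w})$ is even; (iii) $T_{\mathcal{A}}\big((y_0^{s-1}y_1\mathbf{u})\,ш\,\mathbf{v}\big)=(-1)^s\,T_{\mathcal{A}}\big(\mathbf{u}\,ш\,(y_0^{s-1}y_1\mathbf{v})\big)$ if $\operatorname{dep}(\mathbf{u})+\operatorname{dep}(\mathbf{v})$ is odd. Here $ш$ denotes the shuffle product of words.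
   Context: $\mathbb{N}$ is the set of positive integers and $\mathcal{P}$ the set of primes. $\mathcal{A}:=\prod_{p\in\mathcal{P}}(\mathbb{Z}/p\mathbb{Z})\big/\bigoplus_{p\in\mathcal{P}}(\mathbb{Z}/p\mathbb{Z})$, which is a $\mathbb{Q}$-algebra; two elements are equal iff their components agree for all but finitely many $p$. Finite alternating multiple $T$-values: for $\mathbf{s}=(s_1,\dots,s_d)\in\mathbb{N}^d$ and $\boldsymbol{\sigma}=(\sigma_1,\dots,\sigma_d)\in\{\pm1\}^d$, $$T_{\mathcal{A}}(\mathbf{s};\boldsymbol{\sigma}):=\Bigg(\sum_{\substack{p>n_1>\dots>n_d>0\\ n_j\equiv d-j+1\ (\mathrm{mod}\ 2)}}\ \prod_{j=1}^d\frac{\sigma_j^{(n_j-d+j-1)/2}}{n_j^{s_j}}\ (\mathrm{mod}\ p)\Bigg)_{p\in\mathcal{P}}\in\mathcal{A}.$$ $\mathfrak{T}_1^*$ (resp. $\mathfrak{T}_2^*$) is the $\mathbb{Q}$-algebra of words (including the empty word $1$) on the alphabet $\{y_0,y_1\}$ (resp. $\{y_0,y_1,y_{-1}\}$) with concatenation as product, and $\mathfrak{T}_j^1$ is the subalgebra generated by the words not ending with $y_0$. The depth $\operatorname{dep}$ of a word is the number of its letters different from $y_0$. Every word of $\mathfrak{T}_2^1$ is uniquely of the form $y_0^{s_1-1}y_{\eta_1}\cdots y_0^{s_d-1}y_{\eta_d}$ with $s_j\in\mathbb{N}$, $\eta_j=\pm1$, and one sets $$T_{\mathcal{A}}(y_0^{s_1-1}y_{\eta_1}\cdots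 y_0^{s_d-1}y_{\eta_d}):=T_{\mathcal{A}}(s_1,\dots,s_d;\sigma_1,\dots,\sigma_d),\quad \sigma_1=\eta_1,\ \sigma_j=\eta_j/\eta_{j-1}\ (j\ge2),$$ with $T_{\mathcal{A}}(1)=1$ for the empty word, extended $\mathbb{Q}$-linearly to $\mathfrak{T}_2^1$. The map $\tau$ on words of $\mathfrak{T}_1^1$ is given by $\tau(1)=1$ and $\tau(y_0^{s_1-1}y_1\cdots y_0^{s_d-1}y_1)=(-1)^{s_1+\dots+s_d}\,y_0^{s_d-1}y_1\cdots y_0^{s_1-1}y_1$. *)

(* Defs.v *)
From HB Require Import structures.
From mathcomp Require Import all_boot all_order all_algebra.
From mathcomp Require Import boolp classical_sets functions cardinality.
From mathcomp Require Import finmap.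
From mathcomp Require Import ring.
From mathcomp.multinomials Require Import monalg.

Set Implicit Arguments.
Unset Strict Implicit.
Unset Printing Implicit Defensive.

Import GRing.Theory Num.Theory.
Local Open Scope ring_scope.

(** The Q-algebra A = (prod_p Z/pZ) / (bigoplus_p Z/pZ) *)

Definition primeT := {p : nat | prime p}.

Definition Fprod := forall p : primeT, 'F_(val p).

HB.instance Definition _ := Choice.on Fprod.

Section FprodRing.
Implicit Types x y z : Fprod.

Let add x y : Fprod := fun p => x p + y p.
Let opp x : Fprod := fun p => - x p.
Let mul x y : Fprod := fun p => x p * y p.

Fact Fprod_addA : associative add.
Proof. by move=> x y z; apply: functional_extensionality_dep => p; apply: addrA. Qed.
Fact Fprod_addC : commutative add.
Proof. by move=> x y; apply: functional_extensionality_dep => p; apply: addrC. Qed.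
Fact Fprod_add0 : left_id (fun=> 0) add.
Proof. by move=> x; apply: functional_extensionality_dep => p; apply: add0r. Qed.
Fact Fprod_addN : left_inverse (fun=> 0) opp add.
Proof. by move=> x; apply: functional_extensionality_dep => p; apply: addNr. Qed.

HB.instance Definition _ := GRing.isZmodule.Build Fprod
  Fprod_addA Fprod_addC Fprod_add0 Fprod_addN.

Fact Fprod_mulA : associative mul.
Proof. by move=> x y z; apply: functional_extensionality_dep => p; apply: mulrA. Qed.
Fact Fprod_mulC : commutative mul.
Proof. by move=> x y; apply: functional_extensionality_dep => p; apply: mulrC. Qed.
Fact Fprod_mul1 : left_id (fun=> 1) mul.
Proof. by move=> x; apply: functional_extensionality_dep => p; apply: mul1r. Qed.
Fact Fprod_mulD : left_distributive mul add.
Proof. by move=> x y z; apply: functional_extensionality_dep => p; apply: mulrDl. Qed.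
Fact Fprod_1neq0 : ((fun=> 1) : Fprod) != 0.
Proof.
apply/eqP => /(congr1 (fun f : Fprod => f (exist _ 2 isT))) /eqP.
by rewrite oner_eq0.
Qed.

HB.instance Definition _ := GRing.Zmodule_isComNzRing.Build Fprod
  Fprod_mulA Fprod_mulC Fprod_mul1 Fprod_mulD Fprod_1neq0.

End FprodRing.

Definition Fsum : pred Fprod :=
  fun x => `[< finite_set [set p : primeT | x p != 0] >].

Lemma primeT_infinite : infinite_set [set: primeT].
Proof.
move=> fin.
have : finite_set (val @` [set: primeT])%classic by exact: finite_image.
move=> /finite_fsetP[F FE].
have [p pgt pr] := prime_above (\max_(i <- F) i).
have pF : p \in F.
  have : (val @` [set: primeT])%classic p by exists (exist _ p pr).
  by rewrite FE.
by move: pgt; rewrite ltnNge (@leq_bigmax_seq _ _ _ id).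
Qed.

Lemma FsumP (x : Fprod) : reflect (finite_set [set p | x p != 0]) (x \in Fsum).
Proof. exact: asboolP. Qed.

Fact Fsum_ideal : idealr_closed Fsum.
Proof.
split.
- apply/FsumP; by apply: (sub_finite_set (B := set0)).
- apply/negP => /FsumP fin; apply: primeT_infinite.
  by apply: sub_finite_set fin => p _; exact: (oner_neq0 'F_(val p)).
- move=> a x y /FsumP xf /FsumP yf; apply/FsumP.
  have : finite_set ([set p | x p != 0] `|` [set p | y p != 0])%classic.
    by rewrite finite_setU.
  apply: sub_finite_set => p /= axy.
  have [x0|] := eqVneq (x p) 0; last by left.
  right; apply: contra axy => /eqP y0; apply/eqP.
  by rewrite -[LHS]/(a p * x p + y p) x0 y0 mulr0 addr0.
Qed.

HB.instance Definition _ := isIdealr.Build Fprod Fsum Fsum_ideal.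

Definition calA := {ideal_quot (Idealr.clone Fprod Fsum _)}.

HB.instance Definition _ := GRing.ComNzRing.on calA.
HB.instance Definition _ := EqQuotient.on calA.

Definition piA (x : Fprod) : calA := (\pi_calA x)%qT.

Lemma piA_eqP (x y : Fprod) :
  piA x = piA y <-> finite_set [set p : primeT | x p != y p].
Proof.
rewrite /piA; split.
  move/eqP; rewrite -Quotient.idealrBE => /FsumP.
  apply: sub_finite_set => p /=.
  by rewrite -[X in _ -> is_true (X != 0)]/(x p - y p) subr_eq0.
move=> h; apply/eqP; rewrite -Quotient.idealrBE; apply/FsumP.
by apply: sub_finite_set h => p /=; rewrite -[X in X != 0]/(x p - y p) subr_eq0.
Qed.

(* The denominator of q is invertible modulo almost every p, so the junk value
   of ratr at the other primes is irrelevant in A *)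
Definition ratA (q : rat) : calA := piA (fun p => ratr q).


Lemma intr_Fp_neq0_finite (D : int) : D != 0 ->
  finite_set [set p : primeT | D%:~R == 0 :> 'F_(val p)].
Proof.
move=> D0.
have : finite_set (val @^-1` `I_(`|D|%N.+1) : set primeT)%classic.
  by apply: finite_preimage (finite_II _) => x y _ _; apply: val_inj.
apply: sub_finite_set => -[p pr] /= Dp; rewrite /= ltnS.
apply: dvdn_leq; first by rewrite absz_gt0.
rewrite (dvdn_pcharf (pchar_Fp pr)).
move: Dp; case: (D) => n //.
by rewrite NegzE abszN absz_nat rmorphN oppr_eq0.
Qed.

Lemma piA_eq_outside (x y : Fprod) (D : int) : D != 0 ->
    (forall p : primeT, D%:~R != 0 :> 'F_(val p) -> x p = y p) ->
  piA x = piA y.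
Proof.
move=> D0 xy; apply/piA_eqP.
apply: sub_finite_set (intr_Fp_neq0_finite D0) => p /=.
by apply: contraNT => /xy ->.
Qed.

Lemma ratAD : {morph ratA : q r / q + r}.
Proof.
move=> q r; rewrite /ratA -[RHS]rmorphD /=.
apply: (@piA_eq_outside _ _ (denq q * denq r * denq (q + r))).
  by rewrite !mulf_neq0 ?denq_neq0.
move=> p; rewrite !rmorphM /= !mulf_eq0 !negb_or => /andP[/andP[q0 r0] s0].
rewrite -[RHS]/(ratr q + ratr r : 'F_(val p)) /ratr.
have : numq (q + r) * (denq q * denq r) =
       (numq q * denq r + numq r * denq q) * denq (q + r).
  apply: (@intr_inj rat); rewrite !(rmorphM, rmorphD) /= !numqE; ring.
move=> /(congr1 (fun z : int => z%:~R : 'F_(val p))).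
rewrite !(rmorphM, rmorphD) /= => E.
rewrite addf_div // ; apply/eqP; rewrite eqr_div ?mulf_neq0 //.
by apply/eqP.
Qed.

Lemma ratAM : {morph ratA : q r / q * r}.
Proof.
move=> q r; rewrite /ratA -[RHS]rmorphM /=.
apply: (@piA_eq_outside _ _ (denq q * denq r * denq (q * r))).
  by rewrite !mulf_neq0 ?denq_neq0.
move=> p; rewrite !rmorphM /= !mulf_eq0 !negb_or => /andP[/andP[q0 r0] s0].
rewrite -[RHS]/(ratr q * ratr r : 'F_(val p)) /ratr.
have : numq (q * r) * (denq q * denq r) =
       (numq q * numq r) * denq (q * r).
  apply: (@intr_inj rat); rewrite !rmorphM /= !numqE; ring.
move=> /(congr1 (fun z : int => z%:~R : 'F_(val p))).
rewrite !rmorphM /= => E.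
rewrite mulf_div; apply/eqP; rewrite eqr_div ?mulf_neq0 //.
by apply/eqP.
Qed.

Lemma ratA1 : ratA 1 = 1.
Proof.
rewrite /ratA -[RHS](rmorph1 (\pi_calA)%qT); congr (\pi_calA _)%qT.
by apply: functional_extensionality_dep => p; rewrite /ratr divr1.
Qed.

Definition scaleA (q : rat) (x : calA) : calA := ratA q * x.

Fact scaleA_A a b x : scaleA a (scaleA b x) = scaleA (a * b) x.
Proof. by rewrite /scaleA ratAM mulrA. Qed.
Fact scaleA_1 : left_id 1 scaleA.
Proof. by move=> x; rewrite /scaleA ratA1 mul1r. Qed.
Fact scaleA_Dr : right_distributive scaleA +%R.
Proof. by move=> q x y; rewrite /scaleA mulrDr. Qed.
Fact scaleA_Dl x : {morph scaleA^~ x : a b / a + b}.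
Proof. by move=> a b; rewrite /scaleA ratAD mulrDl. Qed.
HB.instance Definition _ := GRing.Zmodule_isLmodule.Build rat calA
  scaleA_A scaleA_1 scaleA_Dr scaleA_Dl.

Fact scaleA_AMl (a : rat) (x y : calA) : a *: (x * y) = (a *: x) * y.
Proof. exact: mulrA. Qed.
HB.instance Definition _ := GRing.Lmodule_isLalgebra.Build rat calA scaleA_AMl.

Fact scaleA_AMr (a : rat) (x y : calA) : a *: (x * y) = x * (a *: y).
Proof. exact: mulrCA. Qed.
HB.instance Definition _ := GRing.Lalgebra_isAlgebra.Build rat calA scaleA_AMr.


(** Finite alternating multiple T-values. Tuples are indexed from 0: the usual
    index j in 1, ..., d is i.+1 with i : 'I_d, so d - j + 1 = d - i. *)

Definition T_index p d (n : {ffun 'I_d -> 'I_p}) : bool :=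
  [&& [forall i : 'I_d, forall j : 'I_d, (i < j)%N ==> (n j < n i)%N],
      [forall i : 'I_d, (0 < n i)%N] &
      [forall i : 'I_d, n i == d - i %[mod 2]]%N].

(* On the summation range n i >= d - i, and (n i - (d - i)) is even, so that the
   truncated subtraction and the halving are exact *)
Definition T_mod p d (s : 'I_d -> nat) (sigma : 'I_d -> int) : 'F_p :=
  \sum_(n : {ffun 'I_d -> 'I_p} | T_index n)
    \prod_(i < d) ((sigma i)%:~R ^+ (n i - (d - i))./2 / (n i)%:R ^+ (s i)).

Definition T_val d (s : 'I_d -> nat) (sigma : 'I_d -> int) : calA :=
  piA (fun p => T_mod (val p) s sigma).

Inductive letter := y0 | y1 | ym1.

Definition letter_code (a : letter) : option bool :=
  match a with y0 => None | y1 => Some true | ym1 => Some false end.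
Definition letter_decode (c : option bool) : letter :=
  match c with None => y0 | Some true => y1 | Some false => ym1 end.
Lemma letter_codeK : cancel letter_code letter_decode.
Proof. by case. Qed.
HB.instance Definition _ := Countable.copy letter (can_type letter_codeK).

(* Words of T_1^* are the words of T_2^* in which y_{-1} does not occur. *)
Notation word := {fmonom letter}.
Notation wordAlg := {malg rat[{fmonom letter}]}.

Definition word_T1 (w : word) : bool := ym1 \notin (w : seq letter).

Definition word_not_end_y0 (w : word) : bool := last y1 w != y0.

Definition word_T11 (w : word) : bool := word_T1 w && word_not_end_y0 w.
Definition word_T21 (w : word) : bool := word_not_end_y0 w.

Definition dep (w : word) : nat := count (predC1 y0) w.

(* y_0^{s_1-1} y_{eta_1} ... y_0^{s_d-1} y_{eta_d} is read as the sequence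
   (s_1, y_{eta_1}), ..., (s_d, y_{eta_d}); a final run of y_0 is dropped *)
Fixpoint blocks_from (k : nat) (w : seq letter) : seq (nat * letter) :=
  match w with
  | [::] => [::]
  | y0 :: w' => blocks_from k.+1 w'
  | a :: w' => (k.+1, a) :: blocks_from 0%N w'
  end.

Definition blocks (w : word) : seq (nat * letter) := blocks_from 0%N w.

Definition word_of_blocks (b : seq (nat * letter)) : word :=
  FMonom (flatten [seq rcons (nseq x.1.-1 y0) x.2 | x <- b]).

Lemma blocksK (w : word) : word_not_end_y0 w -> word_of_blocks (blocks w) = w.
Proof.
case: w => w; rewrite /word_not_end_y0 /word_of_blocks /blocks /= => we.
congr FMonom.
suff H k : last y1 w != y0 -> (k = 0%N \/ w <> [::]) ->
    flatten [seq rcons (nseq x.1.-1 y0) x.2 | x <- blocks_from k w] =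
    nseq k y0 ++ w.
  by rewrite H //; left.
elim: w k {we} => [|a w IH] k /= we hk; first by case: hk => // ->.
have cat_block c : flatten [seq rcons (nseq x.1.-1 y0) x.2
    | x <- (k.+1, c) :: blocks_from 0%N w] = rcons (nseq k y0) c ++
    flatten [seq rcons (nseq x.1.-1 y0) x.2 | x <- blocks_from 0%N w] by [].
have we' : last y1 w != y0 by case: (w) we {hk} => //; case: (a).
have w0 : a = y0 -> w <> [::] by move=> ay0 w0; rewrite ay0 w0 in we.
case: a {we hk} w0 => w0; rewrite ?cat_block IH ?cat_rcons //; try by left.
  by rewrite -cat_rcons -[k.+1]addn1 nseqD cats1.
by right; apply: w0.
Qed.

Definition eta (a : letter) : int :=
  match a with y0 => 0 | y1 => 1 | ym1 => -1 end.

Definition T_word (w : word) : calA :=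
  let b := blocks w in
  let s i := (nth (0%N, y0) b i).1 in
  let e i := eta (nth (0%N, y0) b i).2 in
  T_val (d := size b) (fun i => s i)
    (fun i => if val i == 0%N then e 0%N else e i / e i.-1).

(* The Q-linear extension; its value is only meaningful on the span of the words
   not ending with y_0 *)
Definition T_A (f : wordAlg) : calA := \sum_(w <- msupp f) f@_w *: T_word w.

Lemma T_A_widen (d : {fset word}) (f : wordAlg) : (msupp f `<=` d)%fset ->
  T_A f = \sum_(w <- d) f@_w *: T_word w.
Proof.
move=> le; rewrite /T_A (big_fset_incl _ le) // => w _ /mcoeff_outdom ->.
by rewrite scale0r.
Qed.

Lemma T_A_is_linear : linear T_A.
Proof.
move=> c f g.
pose d := (msupp f `|` msupp g `|` msupp (c *: f + g))%fset.
rewrite (@T_A_widen d (c *: f + g)) ?fsubsetUr //.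
rewrite (@T_A_widen d f); last by rewrite /d -fsetUA fsubsetUl.
rewrite (@T_A_widen d g); last by rewrite /d fsetUAC fsubsetUr.
rewrite scaler_sumr -big_split /=; apply: eq_bigr => w _.
by rewrite mcoeffD mcoeffZ scalerDl scalerA.
Qed.

HB.instance Definition _ :=
  GRing.isLinear.Build rat wordAlg calA *:%R T_A T_A_is_linear.

Lemma T_A_word (w : word) : T_A << w >> = T_word w.
Proof.
by rewrite (T_A_widen msuppU_le) big_seq_fset1 mcoeffUU scale1r.
Qed.

Lemma T_A1 : T_A 1 = 1.
Proof.
rewrite (_ : (1 : wordAlg) = << mone : word >>) // T_A_word /T_word.
have -> : blocks mone = [::] by rewrite /blocks fm1.
rewrite /T_val -[RHS](rmorph1 (\pi_calA)%qT); congr (\pi_calA _)%qT.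
apply: functional_extensionality_dep => p; rewrite /T_mod.
pose n0 : {ffun 'I_0 -> 'I_(val p)} :=
  finfun.ffun0 (card_ord 0).
rewrite (big_pred1 n0) ?big_ord0 // => n /=.
rewrite (_ : n = n0) ?eqxx; last by apply/ffunP => -[].
by apply/and3P; split; apply/forallP => -[].
Qed.

Definition tau (w : word) : wordAlg :=
  let b := blocks w in
  (-1) ^+ (\sum_(x <- b) x.1) *: << word_of_blocks (rev b) >>.

Fixpoint shuffle_seq (u : seq letter) : seq letter -> wordAlg :=
  match u with
  | [::] => fun v => << FMonom v >>
  | a :: u' =>
    fix aux (v : seq letter) : wordAlg :=
      match v with
      | [::] => << FMonom u >>
      | b :: v' => << fmu a >> * shuffle_seq u' v + << fmu b >> * aux v'
      end
  end.

Definition shuffle (f g : wordAlg) : wordAlg :=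
  \sum_(u <- msupp f) \sum_(v <- msupp g) (f@_u * g@_v) *: shuffle_seq u v.

Lemma shuffle_word (u v : word) : shuffle << u >> << v >> = shuffle_seq u v.
Proof.
rewrite /shuffle !msuppU oner_eq0 !big_seq_fset1 !mcoeffUU mulr1 scale1r.
by [].
Qed.

(* y_0^{s-1} y_1 *)
Definition zword (s : nat) : word := FMonom (rcons (nseq s.-1 y0) y1).

(* Main.v *)
(** The sum T(w) modulo p is the sum of the coefficients of t^n, n < p, of the
    iterated integral F_w(t) of the word w in the forms dt / t and
    dt / (1 - eta t^2), and F_u F_v is the integral of the shuffle of u and v.
    The coefficient of t^n in F_w vanishes unless n and dep(w) have the same
    parity, so for odd p and dep(w) even T(w) is p times the coefficient of t^p
    in F_{y_1 w}. In
      y_1 ((y_0^{s-1} y_1 u) sh v) - (-1)^s y_1 (u sh (y_0^{s-1} y_1 v))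
        = sum_{i < s} (-1)^i (y_0^{s-1-i} y_1 u) sh (y_0^i y_1 v)
    each term on the right is a product of two series without constant term,
    whose coefficient of t^p is p-integral; this gives (iii). Moving the blocks
    of w one at a time from the left factor to the right one gives (ii), and (i)
    is its case of an empty remaining word. *)

Require Import Defs.
From mathcomp Require Import all_boot all_order all_algebra.
From mathcomp Require Import finmap.
From mathcomp.multinomials Require Import monalg.

Set Implicit Arguments.
Unset Strict Implicit.
Unset Printing Implicit Defensive.

Import GRing.Theory.
Local Open Scope ring_scope.

(** * Cauchy products of coefficient sequences *)

Definition conv (R : comNzRingType) (f g : nat -> R) (n : nat) : R :=
  \sum_(k < n.+1) f k * g (n - k)%N.

Lemma eq_conv (R : comNzRingType) (f f' g g' : nat -> R) n :
    (forall k, (k <= n)%N -> f k = f' k) ->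
    (forall k, (k <= n)%N -> g k = g' k) ->
  conv f g n = conv f' g' n.
Proof.
move=> ff gg; apply: eq_bigr => k _.
by rewrite ff ?gg ?leq_subr // -ltnS.
Qed.

(** Truncation at [N] leaves the coefficients below [N] intact, so the ring laws of polynomials pass
    to [conv]. *)
Lemma conv_coefM (R : comNzRingType) (N : nat) (f g : nat -> R) n : (n < N)%N ->
  conv f g n = (\poly_(i < N) f i * \poly_(i < N) g i)`_n.
Proof.
move=> nN; rewrite coefM; apply: eq_bigr => k _.
rewrite !coef_poly (leq_trans (ltn_ord k) nN).
by rewrite (leq_ltn_trans (leq_subr k n) nN).
Qed.

Lemma convC (R : comNzRingType) (f g : nat -> R) n : conv f g n = conv g f n.
Proof. by rewrite !(conv_coefM _ _ (ltnSn n)) mulrC. Qed.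

Lemma conv_trunc (R : comNzRingType) (N : nat) (f : nat -> R) (p : {poly R}) n :
  (n < N)%N -> conv f (fun k => p`_k) n = (\poly_(i < N) f i * p)`_n.
Proof.
move=> nN; rewrite coefM; apply: eq_bigr => k _.
by rewrite coef_poly (leq_trans (ltn_ord k) nN).
Qed.

Lemma convA (R : comNzRingType) (f g h : nat -> R) n :
  conv f (conv g h) n = conv (conv f g) h n.
Proof.
pose P (f : nat -> R) := \poly_(i < n.+1) f i.
transitivity (P f * (P g * P h))`_n.
  rewrite -(conv_trunc f _ (ltnSn n)); apply: eq_conv => // k kn.
  exact: conv_coefM.
rewrite mulrA mulrC -(conv_trunc h _ (ltnSn n)) convC.
by apply: eq_conv => // k kn; exact/esym/conv_coefM.
Qed.

Lemma conv_suml (R : comNzRingType) (I : Type) (r : seq I) (F : I -> nat -> R)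
    (g : nat -> R) n :
  conv (fun k => \sum_(i <- r) F i k) g n = \sum_(i <- r) conv (F i) g n.
Proof.
rewrite [RHS]exchange_big; apply: eq_bigr => k _.
by rewrite mulr_suml.
Qed.

Lemma conv_deltal (R : comNzRingType) (g : nat -> R) n :
  conv (fun k => (k == 0)%:R) g n = g n.
Proof.
rewrite /conv big_ord_recl eqxx mul1r subn0 big1 ?addr0 // => i _.
by rewrite mul0r.
Qed.

Lemma conv_at0 (R : comNzRingType) (f g : nat -> R) : conv f g 0 = f 0 * g 0.
Proof. by rewrite /conv big_ord_recl big_ord0 addr0. Qed.

(** Leibniz rule for the Euler operator t d/dt. *)
Lemma conv_euler (R : comNzRingType) (f g : nat -> R) n :
  conv (fun k => k%:R * f k) g n + conv f (fun k => k%:R * g k) n =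
  n%:R * conv f g n.
Proof.
rewrite /conv -big_split mulr_sumr; apply: eq_bigr => k _ /=.
by rewrite mulrCA -mulrA -mulrDl -natrD subnKC // -ltnS.
Qed.

Lemma conv_parity (R : comNzRingType) (f g : nat -> R) (a b : bool) :
    (forall n, odd n != a -> f n = 0) -> (forall n, odd n != b -> g n = 0) ->
  forall n, odd n != a (+) b -> conv f g n = 0.
Proof.
move=> fa gb n nab; apply: big1 => k _.
have [ka|/fa ->] := eqVneq (odd k) a; last by rewrite mul0r.
have kn : (k <= n)%N by rewrite -ltnS.
rewrite gb ?mulr0 // oddB // ka.
by apply: contra nab => /eqP <-; rewrite addbC addbK.
Qed.

(** * Coefficients of iterated integrals *)

(* Coefficients of t * omega_a / dt for the forms omega_{y_0} = dt / t and
   omega_{y_eta} = dt / (1 - eta t^2). *)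
Definition form_coef (F : fieldType) (a : letter) (n : nat) : F :=
  if a is y0 then (n == 0)%:R
  else if odd n then (eta a)%:~R ^+ n./2 else 0.

(* Taylor coefficients of the iterated integral of a word; as 0^-1 = 0, the
   constant term vanishes for a nonempty word, and so does the coefficient of
   index p in characteristic p. *)
Fixpoint word_coef (F : fieldType) (w : seq letter) : nat -> F :=
  match w with
  | [::] => fun n => (n == 0)%:R
  | a :: w' => fun n => n%:R^-1 * conv (form_coef F a) (word_coef F w') n
  end.

Lemma word_coef_cons0 (F : fieldType) a w : word_coef F (a :: w) 0 = 0.
Proof. by rewrite /= invr0 mul0r. Qed.

(** The form of [y0] is even in t and the others are odd, so each letter other than [y0] switches
    the parity. *)
Lemma word_coef_parity (F : fieldType) w n :
  odd n != odd (count (predC1 y0) w) -> word_coef F w n = 0.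
Proof.
elim: w n => [|a w IH] n /=; first by case: n.
rewrite oddD => nw; rewrite (@conv_parity _ _ _ (a != y0) _ _ IH) ?mulr0 //.
  by case: a {nw} => -[|m] //=; case: odd.
by move: nw; case: (a) => /=; case: odd; case: odd.
Qed.

Lemma last_y0_cons (a : letter) w :
  last y1 (a :: w) != y0 -> last y1 w != y0 /\ (a = y0 -> w <> [::]).
Proof. by case: w => [|b w] //= /eqP ay0; split. Qed.

(** The Euler operator undoes the outermost integration. At [n = 0] the right side vanishes too:
    either [form_coef F a 0 = 0], or [a] is [y0] and [w] is nonempty, hence without constant
    term. *)
Lemma natf_word_coef (F : fieldType) a w n :
    last y1 (a :: w) != y0 -> (n = 0%N \/ n%:R != 0 :> F) ->
  n%:R * word_coef F (a :: w) n = conv (form_coef F a) (word_coef F w) n.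
Proof.
move=> /last_y0_cons[_ aw] [->|n0]; last by rewrite /= mulVKf.
rewrite mul0r conv_at0; case: a aw => //= aw; rewrite ?mul0r //.
by case: w aw => [/(_ erefl)|b w _] //; rewrite word_coef_cons0 mulr0.
Qed.

(** * Shuffles of words and products of iterated integrals *)

(** A list with multiplicities, so that the product formula can be proved over a field before the
    word algebra enters. *)
Fixpoint shuffles (u : seq letter) : seq letter -> seq (seq letter) :=
  match u with
  | [::] => fun v => [:: v]
  | a :: u' =>
    fix aux (v : seq letter) : seq (seq letter) :=
      match v with
      | [::] => [:: u]
      | b :: v' => map (cons a) (shuffles u' v) ++ map (cons b) (aux v')
      end
  end.

Lemma size_shuffles u v :
  {in shuffles u v, forall w, size w = size u + size v}%N.
Proof.
elim: u v => [|a u IHu]; first by move=> v w; rewrite inE => /eqP ->.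
elim=> [|b v IHv] w /=; first by rewrite inE addn0 => /eqP ->.
rewrite mem_cat => /orP[] /mapP[x] => [/IHu|/IHv] sx -> /=; rewrite sx //.
by rewrite addnS.
Qed.

Lemma shuffles_last u v :
    last y1 u != y0 -> last y1 v != y0 ->
  {in shuffles u v, forall w, last y1 w != y0}.
Proof.
elim: u v => [|a u IHu] v uy vy; first by move=> w; rewrite inE => /eqP ->.
elim: v vy => [|b v IHv] vy w; first by rewrite inE => /eqP ->.
have [uy' u0] := last_y0_cons uy; have [vy' v0] := last_y0_cons vy.
have nn c x : w = c :: x -> last y1 x != y0 -> (c = y0 -> x <> [::]) ->
    last y1 w != y0.
  by by move=> ->; case: x => [|d x] //= _; case: c => // /(_ erefl).
rewrite mem_cat => /orP[] /mapP[x xin wE].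
  apply: (nn _ _ wE); first exact: (IHu _ uy' vy).
  by move=> _ x0; have := size_shuffles xin; rewrite x0 /= addnS.
apply: (nn _ _ wE); first exact: IHv.
by move=> _ x0; have := @size_shuffles (a :: u) v _ xin; rewrite x0.
Qed.

(** Multiplication by [n] obeys the Leibniz rule and strips the first letter of either factor: these
    are the two branches of the shuffle recursion. Dividing by [n] again requires invertible
    indices. *)
Lemma conv_word_coef (F : fieldType) u v n :
    (forall k, (0 < k <= n)%N -> k%:R != 0 :> F) ->
    last y1 u != y0 -> last y1 v != y0 ->
  conv (word_coef F u) (word_coef F v) n =
  \sum_(w <- shuffles u v) word_coef F w n.
Proof.
elim: u v n => [|a u IHu] v n inv uy vy.
  by rewrite big_seq1 /= conv_deltal.
elim: v vy n inv => [|b v IHv] vy n inv.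
  by rewrite big_seq1 convC /= conv_deltal.
have [uy' _] := last_y0_cons uy; have [vy' _] := last_y0_cons vy.
have natf c w k : last y1 (c :: w) != y0 -> (k <= n)%N ->
    k%:R * word_coef F (c :: w) k = conv (form_coef F c) (word_coef F w) k.
  move=> cw kn; apply: natf_word_coef => //.
  by case: k kn => [|k] kn; [left|right; apply: inv].
have inv_le k : (k <= n)%N -> forall j, (0 < j <= k)%N -> j%:R != 0 :> F.
  by move=> kn j /andP[j0 jk]; rewrite inv // j0 (leq_trans jk).
transitivity (n%:R^-1 * (n%:R * conv (word_coef F (a :: u))
                                     (word_coef F (b :: v)) n)).
  case: n inv {IHv natf inv_le} => [|n] inv; last by rewrite mulKf ?inv ?leqnn.
  by rewrite conv_at0 !word_coef_cons0 mul0r !mulr0.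
rewrite -conv_euler.
rewrite (eq_conv (fun k => natf a u k uy) (fun k _ => erefl)).
rewrite [X in _ * (_ + X)](eq_conv (fun k _ => erefl)
  (fun k => natf b v k vy)).
rewrite [shuffles _ _]/(_ ++ map (cons b) (shuffles (a :: u) v)).
rewrite -convA [X in _ * (_ + X)]convC -convA.
rewrite big_cat !big_map /= mulrDr; congr (_ + _).
  rewrite -mulr_sumr; congr (_ * _).
  under eq_bigr do rewrite convC.
  rewrite -conv_suml convC; apply: eq_conv => // k kn.
  exact: IHu (inv_le k kn) uy' vy.
rewrite -mulr_sumr; congr (_ * _).
under eq_bigr do rewrite convC.
rewrite -conv_suml convC; apply: eq_conv => // k kn.
rewrite convC; exact: (IHv vy' k (inv_le k kn)).
Qed.

(** * Moving letters across a product at the index [p] *)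

Lemma natf_neq0_lt_char (F : fieldType) (p : nat) : p \in [pchar F] ->
  forall k, (0 < k < p)%N -> k%:R != 0 :> F.
Proof.
move=> pF k /andP[k0 kp]; rewrite -(dvdn_pcharf pF).
by apply: contraL kp => /(dvdn_leq k0); rewrite -leqNgt.
Qed.

(* The Euler operator applied to a product of two iterated integrals: its
   coefficient at t^p carries the factor p = 0. *)
Lemma conv_word_coef_at_char (F : fieldType) (p : nat) a u b v :
    p \in [pchar F] -> last y1 (a :: u) != y0 -> last y1 (b :: v) != y0 ->
  conv (form_coef F a) (conv (word_coef F u) (word_coef F (b :: v))) p =
  - conv (form_coef F b) (conv (word_coef F (a :: u)) (word_coef F v)) p.
Proof.
move=> pF ay bv; apply/eqP; rewrite -addr_eq0; apply/eqP.
have step c w g : last y1 (c :: w) != y0 -> g 0%N = 0 ->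
    conv (form_coef F c) (conv (word_coef F w) g) p =
    conv (fun k => k%:R * word_coef F (c :: w) k) g p.
  move=> cw g0; rewrite convA; apply: eq_bigr => k _.
  (* Multiplying by [k] cannot undo the integration at [k = p], where [p%:R = 0], but that term
     carries the factor [g 0 = 0]. *)
  have [kp|pk] := ltnP k p; last first.
    have /eqP -> : (p - k == 0)%N by rewrite subn_eq0.
    by rewrite g0 !mulr0.
  rewrite natf_word_coef //; case: (posnP k) => [->|k0]; first by left.
  by right; apply: (natf_neq0_lt_char pF); rewrite k0.
rewrite step ?word_coef_cons0 //.
rewrite [X in _ + X](_ : _ = conv (word_coef F (a :: u))
    (fun k => k%:R * word_coef F (b :: v) k) p); last first.
  rewrite [RHS]convC -step ?word_coef_cons0 //.
  by apply: eq_conv => // k _; rewrite convC.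
by rewrite conv_euler (pcharf0 pF) mul0r.
Qed.

Lemma last_nseq_cat (u : seq letter) s :
  last y1 u != y0 -> last y1 (nseq s y0 ++ y1 :: u) != y0.
Proof. by rewrite last_cat; case: u. Qed.

(** The form of [y0] is the unit of [conv], so [conv_word_coef_at_char] with two letters [y0]
    carries one of them across for a sign; this is repeated [k] times. *)
Lemma conv_y0_shift (F : fieldType) (p : nat) i j k u v : p \in [pchar F] ->
    last y1 u != y0 -> last y1 v != y0 ->
  conv (word_coef F (nseq (j + k) y0 ++ y1 :: u))
       (word_coef F (nseq i y0 ++ y1 :: v)) p =
  (-1) ^+ k * conv (word_coef F (nseq j y0 ++ y1 :: u))
                   (word_coef F (nseq (i + k) y0 ++ y1 :: v)) p.
Proof.
move=> pF uy vy; elim: k i => [|k IH] i; first by rewrite !addn0 mul1r.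
have := @conv_word_coef_at_char F p y0 (nseq (j + k) y0 ++ y1 :: u)
  y0 (nseq i y0 ++ y1 :: v) pF (last_nseq_cat (j + k).+1 uy)
  (last_nseq_cat i.+1 vy).
rewrite !conv_deltal addnS exprS mulN1r mulNr => /esym/eqP.
rewrite eqr_oppLR => /eqP ->.
by rewrite (IH i.+1) addSnnS.
Qed.

(** For [s > 0], a first exchange puts the outer [y1] in front of [v] and strips a [y0] on the left;
    the other [y0] then cross, and a last exchange makes the [y1] in front of [u] the outer form.
    Each of the [s.+1] exchanges costs a sign. *)
Lemma conv_zword_swap (F : fieldType) (p s : nat) u v : p \in [pchar F] ->
    last y1 u != y0 -> last y1 v != y0 ->
  conv (form_coef F y1)
    (conv (word_coef F (nseq s y0 ++ y1 :: u)) (word_coef F v)) p =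
  (-1) ^+ s.+1 * conv (form_coef F y1)
    (conv (word_coef F u) (word_coef F (nseq s y0 ++ y1 :: v))) p.
Proof.
move=> pF uy vy.
have uz k := last_nseq_cat k uy; have vz k := last_nseq_cat k vy.
case: s => [|s].
  rewrite expr1 mulN1r; apply/esym/eqP; rewrite eqr_oppLR; apply/eqP.
  exact: (conv_word_coef_at_char pF (uz 0%N) (vz 0%N)).
have e1 := conv_word_coef_at_char pF (uz s.+1) (vz 0%N).
have e2 := conv_word_coef_at_char pF (uz 0%N) (vz s.+1).
rewrite [LHS](_ : _ = - conv (word_coef F (nseq (0 + s) y0 ++ y1 :: u))
   (word_coef F (nseq 0 y0 ++ y1 :: v)) p); last first.
  by apply/esym/eqP; rewrite eqr_oppLR -e1 conv_deltal.
rewrite conv_y0_shift // [X in _ = _ * X]e2 conv_deltal !exprS.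
by rewrite mulrN !mulN1r opprK.
Qed.

(** For odd [p], the gap [p - k] is odd exactly for even [k], and there the form has coefficient
    1. *)
Lemma conv_form_y1_odd (F : fieldType) (p : nat) (f : nat -> F) : odd p ->
    (forall n, odd n -> f n = 0) ->
  conv (form_coef F y1) f p = \sum_(n < p) f n.
Proof.
move=> op f0; rewrite convC /conv big_ord_recr /= subnn mulr0 addr0.
apply: eq_bigr => k _.
have [ok|ek] := boolP (odd k); first by rewrite f0 ?mul0r.
by rewrite oddB 1?ltnW // op (negPf ek) expr1n mulr1.
Qed.

(* The value modulo p of T_A at the shuffle product of u and v. *)
Definition shuffle_sum (F : fieldType) (p : nat) (u v : seq letter) : F :=
  \sum_(n < p) conv (word_coef F u) (word_coef F v) n.

(** Identity (iii) modulo [p]. The block has depth 1, so both products have even total depth and no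
    odd coefficients; both sums are then coefficients at [p] of a product with the form of [y1]. *)
Lemma shuffle_sum_zword (F : fieldType) (p s : nat) u v : p \in [pchar F] ->
    odd p -> last y1 u != y0 -> last y1 v != y0 ->
    odd (count (predC1 y0) u + count (predC1 y0) v) ->
  shuffle_sum F p (rcons (nseq s y0) y1 ++ u) v =
  (-1) ^+ s.+1 * shuffle_sum F p u (rcons (nseq s y0) y1 ++ v).
Proof.
move=> pF op uy vy uv; rewrite !cat_rcons /shuffle_sum.
rewrite -!conv_form_y1_odd ?conv_zword_swap // => n on.
all: rewrite (conv_parity (@word_coef_parity F _) (@word_coef_parity F _)) //.
all: by rewrite on !count_cat count_nseq /= !oddD /=; move: uv;
  rewrite oddD; case: odd; case: odd.
Qed.

Lemma sum_fibers (V : nmodType) (I : finType) (P : pred I) (t : I -> nat)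
    (N : nat) (G : I -> nat -> V) :
  \sum_(k < N) \sum_(n | P n && (t n == k)) G n k =
  \sum_(n | P n && (t n < N)%N) G n (t n).
Proof.
rewrite (exchange_big_dep P) /=; last by move=> k n _ /andP[].
rewrite [RHS]big_mkcondr; apply: eq_bigr => n Pn; rewrite Pn /=.
have [tN|Nt] := ltnP (t n) N.
  by rewrite (big_pred1 (Ordinal tN)) // => k; rewrite -val_eqE /= eq_sym.
by rewrite big_pred0 // => k; rewrite gtn_eqF // (leq_trans (ltn_ord k)).
Qed.

(** * The sums defining T-values, by their largest index *)

Lemma T_indexP (p d : nat) (n : {ffun 'I_d -> 'I_p}) :
  reflect [/\ forall i j : 'I_d, (i < j)%N -> (n j < n i)%N,
              forall i : 'I_d, (0 < n i)%N &
              forall i : 'I_d, odd (n i) = odd (d - i)] (T_index n).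
Proof.
have oddE (i : 'I_d) : (n i == d - i %[mod 2])%N = (odd (n i) == odd (d - i)).
  by rewrite !modn2; do 2!case: odd.
apply: (iffP and3P) => -[lt_n pos_n odd_n]; split.
- by move=> i j; apply/implyP; move: j; apply/forallP; move: i; apply/forallP.
- exact/forallP.
- by move=> i; apply/eqP; rewrite -oddE; move: i; apply/forallP.
- by apply/forallP => i; apply/forallP => j; apply/implyP/lt_n.
- exact/forallP.
- by apply/forallP => i; rewrite oddE odd_n.
Qed.

(* For the empty index the value is 0, so that the recursion on the depth has no
   special case. *)
Definition T_top (p d : nat) : {ffun 'I_d -> 'I_p} -> nat :=
  match d with 0 => fun=> 0%N | d'.+1 => fun n => n ord0 end.

Definition ffun_cons (T : finType) (d : nat) (a : T) (n : {ffun 'I_d -> T}) :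
  {ffun 'I_d.+1 -> T} := [ffun i => oapp n a (unlift ord0 i)].

Definition ffun_behead (T : finType) (d : nat) (n : {ffun 'I_d.+1 -> T}) :
  {ffun 'I_d -> T} := [ffun i => n (lift ord0 i)].

Lemma ffun_cons0 (T : finType) d (a : T) (n : {ffun 'I_d -> T}) :
  ffun_cons a n ord0 = a.
Proof. by rewrite ffunE unlift_none. Qed.

Lemma ffun_consS (T : finType) d (a : T) (n : {ffun 'I_d -> T}) i :
  ffun_cons a n (lift ord0 i) = n i.
Proof. by rewrite ffunE liftK. Qed.

Lemma ffun_consK (T : finType) d (a : T) (n : {ffun 'I_d -> T}) :
  ffun_behead (ffun_cons a n) = n.
Proof. by apply/ffunP => i; rewrite ffunE ffun_consS. Qed.

Lemma ffun_beheadK (T : finType) d (n : {ffun 'I_d.+1 -> T}) :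
  ffun_cons (n ord0) (ffun_behead n) = n.
Proof.
apply/ffunP => i; case: (unliftP ord0 i) => [j|] ->.
  by rewrite ffun_consS ffunE.
by rewrite ffun_cons0.
Qed.

(** Prepending an index leaves [d - i] unchanged on the tail, so only the two largest indices and
    the parity of the new one matter. For [d = 0] the comparison is the positivity of [a]. *)
Lemma T_index_cons (p d : nat) (a : 'I_p) (n : {ffun 'I_d -> 'I_p}) :
  T_index (ffun_cons a n) =
  [&& T_index n, (T_top n < a)%N & odd a != odd d].
Proof.
apply/T_indexP/and3P => [[lt_n pos_n odd_n]|[/T_indexP n_ok na ad]].
  split.
  - apply/T_indexP; split => [i j ij|i|i].
    + by have := lt_n (lift ord0 i) (lift ord0 j); rewrite !ffun_consS; apply.
    + by have := pos_n (lift ord0 i); rewrite ffun_consS.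
    + by have := odd_n (lift ord0 i); rewrite ffun_consS.
  - case: d n lt_n pos_n {odd_n} => [|d] n lt_n pos_n /=.
      by have := pos_n ord0; rewrite ffun_cons0.
    by have := lt_n ord0 (lift ord0 ord0); rewrite ffun_cons0 ffun_consS; apply.
  - by have := odd_n ord0; rewrite ffun_cons0 subn0 => -> /=; case: odd.
have [lt_n pos_n odd_n] := n_ok; split.
- move=> i j; case: (unliftP ord0 j) => [j'|] ->; last by rewrite ltn0.
  case: (unliftP ord0 i) => [i'|] ->; first by rewrite !ffun_consS; apply: lt_n.
  move=> _; rewrite ffun_cons0 ffun_consS.
  apply: leq_ltn_trans na; case: d n lt_n j' {n_ok pos_n odd_n ad i j} =>
    [|d] n lt_n.
    by case.
  move=> j /=; have [->|j0] := eqVneq j ord0; first exact: leqnn.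
  by apply/ltnW/lt_n; rewrite lt0n.
- move=> i; case: (unliftP ord0 i) => [j|] ->; first by rewrite ffun_consS.
  by rewrite ffun_cons0 (leq_ltn_trans _ na).
move=> i; case: (unliftP ord0 i) => [j|] ->; first by rewrite ffun_consS odd_n.
by rewrite ffun_cons0 subn0 /=; move: ad; do 2!case: odd.
Qed.

Lemma T_index_top (p d : nat) (n : {ffun 'I_d -> 'I_p}) :
  T_index n -> (d <= T_top n)%N /\ odd (T_top n) = odd d.
Proof.
elim: d n => [|d IH] n //; rewrite -(ffun_beheadK n) T_index_cons.
move=> /and3P[/IH[dn _] na ad]; rewrite /= ffun_cons0.
by split; [exact: leq_ltn_trans na | move: ad; do 2!case: odd].
Qed.

Definition block_sigma (b : seq (nat * letter)) (i : nat) : int :=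
  let e i := eta (nth (0%N, y0) b i).2 in
  if i == 0%N then e 0%N else e i / e i.-1.

Definition T_term (p : nat) (b : seq (nat * letter))
    (n : {ffun 'I_(size b) -> 'I_p}) : 'F_p :=
  \prod_(i < size b) ((block_sigma b i)%:~R ^+ (n i - (size b - i))./2 /
                      (n i)%:R ^+ (nth (0%N, y0) b i).1).

Definition T_part (p : nat) (b : seq (nat * letter)) (m : nat) : 'F_p :=
  \sum_(n : {ffun 'I_(size b) -> 'I_p} | T_index n && (T_top n == m)) T_term n.

Lemma sqr_eta (a : letter) : a != y0 -> eta a ^+ 2 = 1.
Proof. by case: a. Qed.

Lemma eta_div (a c : letter) : c != y0 -> eta a / eta c = eta a * eta c.
Proof. by case: c. Qed.

(** The gap [a - t] is odd and [t - d] is even; the extra 1 is lost in halving the odd gap. *)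
Lemma half_sub_chain (a t d : nat) :
    (d <= t)%N -> odd t = odd d -> (t < a)%N -> odd a != odd d ->
  ((a - d.+1)./2 = (a - t)./2 + (t - d)./2)%N.
Proof.
move=> dt td ta ad; rewrite subnS.
have o1 : odd (a - t) by rewrite (oddB (ltnW ta)) td; move: ad; do 2!case: odd.
have e1 : odd (t - d) = false by rewrite oddB // td addbb.
have -> : (a - d = (a - t) + (t - d))%N by rewrite addnBA ?subnK // ltnW.
case: (a - t)%N o1 => // j /= /negbTE oj.
by rewrite halfD e1 andbF uphalf_half oj.
Qed.

(** Let J be half the gap between the two largest indices, rounded down, and K the exponent at the
    second one. The signs enter as eta_1^(J+K) and (eta_2/eta_1)^K; as eta_1^2 = 1, what remains is
    eta_2^K and the form coefficient eta_1^J. *)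
Lemma T_term_cons (p : nat) x b (a : 'I_p) (n : {ffun 'I_(size b) -> 'I_p}) :
    x.2 != y0 -> T_index (ffun_cons a n) ->
  @T_term p (x :: b) (ffun_cons a n) =
  a%:R ^- x.1 * (form_coef _ x.2 (a - T_top n) * T_term n).
Proof.
move=> x0; rewrite T_index_cons => /and3P[/T_index_top[dn on] na ad].
have form_odd : form_coef 'F_p x.2 (a - T_top n) =
    (eta x.2)%:~R ^+ (a - T_top n)./2.
  rewrite /form_coef (oddB (ltnW na)) on.
  by move: x0 ad; case: (x.2) => //= _; do 2!case: odd.
rewrite /T_term big_ord_recl /= ffun_cons0 subn0 form_odd.
under eq_bigr do rewrite ffun_consS /bump leq0n add1n subSS.
rewrite [_ / _]mulrC -mulrA; congr (_ * _).
rewrite (half_sub_chain dn on na ad).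
set J := (a - T_top n)./2; have -> : block_sigma (x :: b) 0 = eta x.2 by [].
case: b n dn on na ad {form_odd} @J => [|y b] n dn on na ad J.
  by rewrite !big_ord0 !mulr1 /= addn0.
rewrite !big_ord_recl /= subn0.
set K := (n ord0 - (size b).+1)./2.
have -> : block_sigma [:: x, y & b] 1 = eta y.2 / eta x.2 by [].
have -> : block_sigma (y :: b) 0 = eta y.2 by [].
rewrite (eta_div _ x0) rmorphM /= exprMn !mulrA; congr (_ / _ * _).
rewrite mulrAC -exprD -addnA addnn exprD -mulrA; congr (_ * _).
by rewrite -mul2n exprM -rmorphXn /= sqr_eta // expr1n mul1r.
Qed.

(** The convolution runs over the second largest index. The gaps forbidden by [T_index_cons], zero
    or even, meet a vanishing form coefficient. *)
Lemma T_part_cons (p : nat) x b m : x.2 != y0 -> (m < p)%N ->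
  T_part p (x :: b) m =
  m%:R ^- x.1 * conv (form_coef _ x.2) (T_part p b) m.
Proof.
move=> x0 mp; rewrite convC /conv /T_part.
under [in RHS]eq_bigr do rewrite mulr_suml.
rewrite (sum_fibers (fun n => T_index n) (@T_top p (size b)) m.+1
  (fun n k => T_term n * form_coef _ x.2 (m - k))).
rewrite (reindex_onto (ffun_cons (Ordinal mp)) (@ffun_behead _ _)); last first.
  move=> n /andP[_ /eqP nm]; rewrite -[RHS]ffun_beheadK; congr ffun_cons.
  exact/val_inj/esym.
rewrite mulr_sumr big_mkcond [RHS]big_mkcond; apply: eq_bigr => n _ /=.
rewrite ffun_cons0 ffun_consK !eqxx !andbT T_index_cons ltnS /=.
have [nT|//] := boolP (T_index n); rewrite /=.
have [_ on] := T_index_top nT.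
have [nm|mn] := ltnP (T_top n) m; last first.
  rewrite /=; case: ifP => // nm.
  have -> : (m - T_top n = 0)%N by apply/eqP; rewrite subn_eq0.
  by rewrite /form_coef; case: (x.2) x0 => // _; rewrite !mulr0.
rewrite (ltnW nm) /=; have [om|om] := boolP (odd m != odd (size b)).
  by rewrite T_term_cons ?T_index_cons ?nT ?nm //= [T_term n * _]mulrC.
have eo : odd (m - T_top n) = false.
  by rewrite (oddB (ltnW nm)) on; move: om; do 2!case: odd.
by rewrite /form_coef eo; case: (x.2) x0 => // _; rewrite !mulr0.
Qed.

Lemma T_index0 (p : nat) (n : {ffun 'I_0 -> 'I_p}) : T_index n.
Proof. by apply/T_indexP; split=> -[]. Qed.

Lemma T_part_nil (p : nat) m : T_part p [::] m = (m == 0%N)%:R.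
Proof.
rewrite /T_part /T_term /=; case: (eqVneq m 0%N) => _; last first.
  by rewrite big_pred0 // => n; rewrite andbF.
rewrite (big_pred1 (finfun.ffun0 (card_ord 0))) ?big_ord0 // => n /=.
rewrite T_index0 (_ : n = finfun.ffun0 (card_ord 0)) ?eqxx //.
by apply/ffunP => -[].
Qed.

(** * From T-sums to coefficients of words, block by block *)

Lemma word_coef_block (F : fieldType) s a w m : (0 < s)%N ->
  word_coef F (rcons (nseq s.-1 y0) a ++ w) m =
  m%:R ^- s * conv (form_coef F a) (word_coef F w) m.
Proof.
case: s => // s _; elim: s => [|s IH] //=.
by rewrite conv_deltal IH mulrA -invfM -exprS.
Qed.

Definition proper_blocks (b : seq (nat * letter)) : bool :=
  all (fun x => (0 < x.1)%N && (x.2 != y0)) b.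

Definition seq_of_blocks (b : seq (nat * letter)) : seq letter :=
  flatten [seq rcons (nseq x.1.-1 y0) x.2 | x <- b].

Lemma seq_of_blocks_cons x b :
  seq_of_blocks (x :: b) = rcons (nseq x.1.-1 y0) x.2 ++ seq_of_blocks b.
Proof. by []. Qed.

Lemma T_part_word_coef (p : nat) b m : proper_blocks b -> (m < p)%N ->
  T_part p b m = word_coef _ (seq_of_blocks b) m.
Proof.
elim: b m => [|x b IH] m /=; first by rewrite T_part_nil.
move=> /andP[/andP[s0 x0] bb] mp.
rewrite T_part_cons // seq_of_blocks_cons.
rewrite word_coef_block //; congr (_ * _); apply: eq_conv => // k km.
by apply: IH; rewrite // (leq_ltn_trans km).
Qed.

Lemma T_mod_word_coef (p : nat) b : (0 < p)%N -> proper_blocks b ->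
  T_mod p (d := size b) (fun i => (nth (0%N, y0) b i).1) (block_sigma b) =
  \sum_(m < p) word_coef _ (seq_of_blocks b) m.
Proof.
move=> p0 bb; transitivity (\sum_(m < p) T_part p b m); last first.
  by apply: eq_bigr => m _; apply: T_part_word_coef.
rewrite /T_part (sum_fibers (fun n => T_index n) (@T_top p (size b)) p
  (fun n _ => T_term n)).
apply: eq_bigl => n; rewrite (_ : (T_top n < p)%N) ?andbT //; move: n.
by case: (size b) => [|d] n; rewrite /T_top ?ltn_ord.
Qed.

Lemma blocks_proper (w : word) : proper_blocks (blocks w).
Proof.
rewrite /blocks; case: w => w /=; elim: w 0%N => [|a w IH] k //=.
by case: a; rewrite /= ?IH.
Qed.

Lemma seq_of_blocksK (w : word) : word_not_end_y0 w ->
  seq_of_blocks (blocks w) = w.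
Proof. by move=> /blocksK {2}<-. Qed.

Lemma T_word_coef (w : word) : word_not_end_y0 w ->
  T_word w = piA (fun p => \sum_(n < val p) word_coef _ w n).
Proof.
move=> wy; rewrite /T_word /T_val; congr piA.
apply: boolp.functional_extensionality_dep => p.
rewrite -(seq_of_blocksK wy) -T_mod_word_coef ?blocks_proper //.
exact/prime_gt0/(valP p).
Qed.

(** * Shuffle products of words *)

Lemma malg_mulU (u v : word) :
  << u >> * << v >> = << FMonom ((u : seq letter) ++ v) >> :> wordAlg.
Proof.
rewrite malgME !msuppU oner_eq0 !big_seq_fset1 !mcoeffUU mulr1.
by congr << _ >>; exact: fmmulE.
Qed.

Lemma shuffle_seqE u v :
  shuffle_seq u v = \sum_(w <- shuffles u v) << FMonom w >>.
Proof.
elim: u v => [|a u IHu] v; first by rewrite big_seq1.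
elim: v => [|b v IHv]; first by rewrite big_seq1.
rewrite [LHS]/(<< fmu a >> * shuffle_seq u (b :: v) +
  << fmu b >> * shuffle_seq (a :: u) v).
rewrite [shuffles _ _]/(_ ++ map (cons b) (shuffles (a :: u) v)).
rewrite IHu IHv big_cat !big_map !mulr_sumr /=.
by congr (_ + _); apply: eq_bigr => w _; rewrite malg_mulU fmuE.
Qed.

Lemma piA_sum (I : eqType) (r : seq I) (f : I -> Fprod) :
  \sum_(i <- r) piA (f i) = piA (fun p => \sum_(i <- r) f i p).
Proof.
rewrite -[LHS](raddf_sum (\pi_calA)%qT); congr piA.
apply: boolp.functional_extensionality_dep => p.
elim: r => [|i r IH]; first by rewrite !big_nil.
by rewrite !big_cons -IH.
Qed.

(** The indices summed are below [p], so the positive ones are invertible in ['F_p] and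
    [conv_word_coef] applies; [shuffles_last] makes [T_word_coef] available for every shuffled
    word. *)
Lemma T_A_shuffle (u v : word) :
    word_not_end_y0 u -> word_not_end_y0 v ->
  T_A (shuffle_seq u v) = piA (fun p => shuffle_sum 'F_(val p) (val p) u v).
Proof.
move=> uy vy; rewrite shuffle_seqE linear_sum /=.
have vE (w : seq letter) : w \in shuffles u v ->
    T_A << FMonom w >> = piA (fun p => \sum_(n < val p) word_coef _ w n).
  by move=> /(shuffles_last uy vy) wy; rewrite T_A_word T_word_coef.
rewrite (eq_big_seq _ vE) piA_sum; congr piA.
apply: boolp.functional_extensionality_dep => -[p pr] /=.
rewrite exchange_big; apply: eq_bigr => n _ /=; rewrite conv_word_coef // => k.
move=> /andP[k0 kn]; apply: (natf_neq0_lt_char (pchar_Fp pr)).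
by rewrite k0 (leq_ltn_trans kn).
Qed.

Lemma shuffle_scaler (u v : word) (c : rat) : c != 0 ->
  shuffle << u >> (c *: << v >>) = c *: shuffle_seq u v.
Proof.
move=> c0; have -> : c *: << v >> = << c *g v >> :> wordAlg.
  by apply/malgP => w; rewrite mcoeffZ !mcoeffU mulr_natr.
rewrite /shuffle !msuppU oner_eq0 (negPf c0) !big_seq_fset1 !mcoeffUU mul1r.
by [].
Qed.

(** * Moving blocks from one factor of the shuffle to the other *)

Definition y1_blocks (b : seq (nat * letter)) : bool :=
  all (fun x => (0 < x.1)%N && (x.2 == y1)) b.

Lemma y1_blocks_proper b : y1_blocks b -> proper_blocks b.
Proof. by apply: sub_all => x /andP[-> /eqP ->]. Qed.

Lemma blocks_y1 (w : word) : word_T1 w -> y1_blocks (blocks w).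
Proof.
rewrite /word_T1 /blocks; case: w => w /=.
elim: w 0%N => [|a w IH] k //; rewrite inE negb_or => /andP[aw /(IH _) wy].
by case: a aw => //= _; apply: wy.
Qed.

Lemma count_seq_of_blocks b : proper_blocks b ->
  count (predC1 y0) (seq_of_blocks b) = size b.
Proof.
elim: b => [|x b IH] //= /andP[/andP[_ x0] /IH bE].
rewrite seq_of_blocks_cons count_cat bE -cats1 count_cat.
by rewrite count_nseq /= x0.
Qed.

Lemma last_seq_of_blocks b u : proper_blocks b -> last y1 u != y0 ->
  last y1 (seq_of_blocks b ++ u) != y0.
Proof.
move=> bb uy; elim: b bb => [|x b IH] //= /andP[/andP[_ x0] /IH].
rewrite seq_of_blocks_cons -catA cat_rcons.
by move: (seq_of_blocks b ++ u) => [|c t]; rewrite last_cat.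
Qed.

Lemma seq_of_blocks_rcons x b :
  seq_of_blocks (rcons b x) = seq_of_blocks b ++ rcons (nseq x.1.-1 y0) x.2.
Proof. by rewrite /seq_of_blocks map_rcons flatten_rcons. Qed.

(** Each block moves to the front of the right word, so the blocks arrive reversed and the signs
    multiply to that of [tau]. The total depth stays even, hence is odd without the block being
    moved, as [shuffle_sum_zword] requires. *)
Lemma shuffle_sum_blocks (F : fieldType) (p : nat) b u v : p \in [pchar F] ->
    odd p -> y1_blocks b -> last y1 u != y0 -> last y1 v != y0 ->
    ~~ odd (count (predC1 y0) u + count (predC1 y0) v + size b) ->
  shuffle_sum F p (seq_of_blocks b ++ u) v =
  (-1) ^+ (\sum_(x <- b) x.1) * shuffle_sum F p u (seq_of_blocks (rev b) ++ v).
Proof.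
move=> pF op; elim: b v => [|[s a] b IH] v; first by rewrite big_nil mul1r.
rewrite /y1_blocks /= -/(y1_blocks b) => /andP[/andP[s0 /eqP ->] bb] uy vy uvb.
rewrite seq_of_blocks_cons -catA /= shuffle_sum_zword //; last first.
- rewrite count_cat count_seq_of_blocks ?y1_blocks_proper // -addnA addnC.
  by move: uvb; rewrite addnS /= negbK.
- exact/last_seq_of_blocks/uy/y1_blocks_proper.
rewrite IH //.
- by rewrite big_cons exprD mulrA prednK // rev_cons seq_of_blocks_rcons catA.
- by rewrite cat_rcons; apply: last_nseq_cat.
- move: uvb; rewrite count_cat -cats1 count_cat count_nseq /= mul0n.
  by rewrite !addnS !addSn.
Qed.

(** * Passage to the quotient [calA] *)

Lemma signr_piA n (x : Fprod) :
  (-1) ^+ n * piA x = piA (fun p => (-1) ^+ n * x p).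
Proof.
have -> : (fun p => (-1) ^+ n * x p) = (-1) ^+ n * x :> Fprod.
  apply: boolp.functional_extensionality_dep => p.
  rewrite -[RHS]/(((-1) ^+ n : Fprod) p * x p); congr (_ * _).
  by elim: n => // n IH; rewrite !exprS IH.
by rewrite /piA [RHS]rmorphM rmorphXn /= rmorphN1.
Qed.

(** The prime 2, which the parity argument does not cover, is invisible in [calA]. *)
Lemma eq_piA_odd (x y : Fprod) :
    (forall p : primeT, odd (val p) -> x p = y p) -> piA x = piA y.
Proof.
move=> xy; apply: (@piA_eq_outside _ _ 2) => // p p2; apply: xy.
case: (even_prime (valP p)) => // pE; move: p2.
by rewrite -[_%:~R]/(2%:R) -(dvdn_pcharf (pchar_Fp (valP p))) pE.
Qed.

Lemma T_A_signr n (f : wordAlg) : T_A ((-1) ^+ n *: f) = (-1) ^+ n * T_A f.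
Proof.
rewrite -signr_odd -[in RHS]signr_odd; case: (odd n).
  by rewrite !expr1 scaleN1r raddfN mulN1r.
by rewrite scale1r mul1r.
Qed.

Lemma T_A_shuffle_tau (w u v : word) :
    word_T11 w -> word_T11 u -> word_T21 v ->
    ~~ odd (dep u + dep v + dep w) ->
  T_A (shuffle (<< w >> * << u >>) << v >>) =
  T_A (shuffle << u >> (tau w * << v >>)).
Proof.
move=> /andP[/blocks_y1 wb wy] /andP[_ uy] vy par.
have wp := y1_blocks_proper wb.
have wpr : proper_blocks (rev (blocks w)) by rewrite /proper_blocks all_rev.
rewrite malg_mulU shuffle_word /tau -scalerAl malg_mulU.
rewrite shuffle_scaler ?signr_eq0 //.
rewrite T_A_signr !T_A_shuffle //; last 2 first.
- exact: last_seq_of_blocks.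
- by rewrite /word_not_end_y0 /= -{1}(seq_of_blocksK wy) last_seq_of_blocks.
rewrite signr_piA; apply: eq_piA_odd => p op /=.
rewrite -{1}(seq_of_blocksK wy) shuffle_sum_blocks //.
- exact/pchar_Fp/(valP p).
- by rewrite -count_seq_of_blocks // (seq_of_blocksK wy).
Qed.

Theorem theorem3p2 (w u v : word) (s : nat) :
    word_T11 w -> word_T11 u -> word_T21 v -> (0 < s)%N ->
  [/\ ~~ odd (dep u + dep v) ->
        T_A (shuffle << u >> << v >>) = T_A (tau u * << v >>),
      ~~ odd (dep u + dep v + dep w) ->
        T_A (shuffle (<< w >> * << u >>) << v >>) =
        T_A (shuffle << u >> (tau w * << v >>)) &
      odd (dep u + dep v) ->
        T_A (shuffle (<< zword s >> * << u >>) << v >>) =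
        (-1) ^+ s * T_A (shuffle << u >> (<< zword s >> * << v >>))].
Proof.
move=> wT uT vT s0; split; [|exact: T_A_shuffle_tau|].
(* (i) is (ii) with [u] as the word to be moved and the empty word left behind. *)
- move=> par; have := @T_A_shuffle_tau u (FMonom [::]) v uT isT vT.
  rewrite add0n addnC => /(_ par); rewrite malg_mulU cats0.
  have -> : FMonom u = u by case: (u).
  move=> ->; rewrite /tau -scalerAl malg_mulU shuffle_scaler ?signr_eq0 //.
- move=> par; have /andP[_ uy] := uT.
  rewrite !malg_mulU !shuffle_word !T_A_shuffle //; last 2 first.
  + by rewrite /word_not_end_y0 /= cat_rcons; apply: last_nseq_cat.
  + by rewrite /word_not_end_y0 /= cat_rcons; apply: last_nseq_cat.
  rewrite signr_piA; apply: eq_piA_odd => p op /=.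
  rewrite shuffle_sum_zword ?(prednK s0) //.
  exact/pchar_Fp/(valP p).
Qed.
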